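(* Let $\mathcal{S}_1$ and $\mathcal{S}_2$ be spanoids on the sets $U_1$ and $U_2$ respectively. Let $M_1,\ldots,M_s\subseteq U_1$ and $N_1,\ldots,N_s\subseteq U_2$ be sets such that for every $i\in U_1$, the span in $\mathcal{S}_2$ of $\bigcup_{j:\, i\in M_j}N_j$ equals $U_2$. Then $R(\mathcal{S}_1\otimes\mathcal{S}_2)\le\sum_{t=1}^s|M_t|\cdot|N_t|$.
   Context: A spanoid $\mathcal{S}$ over a finite set $U$ is a family of pairs $(S,i)$ with $S\subseteq U$, $i\in U$; it is assumed that $(\{i\},i)\in\mathcal{S}$ for all $i$ and that $(S,i)\in\mathcal{S}$ implies $(S',i)\in\mathcal{S}$ for $S\subseteq S'\subseteq U$. A derivation of $i$ from $T\subseteq U$ is a sequence $T=T_0,\ldots,T_r$ with $i\in T_r$, where $T_j=T_{j-1}\cup\{i_j\}$ and $(S,i_j)\in\mathcal{S}$ for some $S\subseteq T_{j-1}$. The span of $T$ is the set of elements derivable from $T$; the rank $R(\mathcal{S})$ is the minimum size of a subset of $U$ whose span is $U$. The product $\mathcal{S}_1\otimes\mathcal{S}_2$ is the spanoid on $U_1\times U_2$ with inference rules: if $(S,i)\in\mathcal{S}_1$ then $(S\times\{j\},(i,j))\in\mathcal{S}_1\otimes\mathcal{S}_2$ for every $j\in U_2$; if $(S,j)\in\mathcal{S}_2$ then $(\{i\}\times S,(i,j))\in\mathcal{S}_1\otimes\mathcal{S}_2$ for every $i\in U_1$. *)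

(* Defs.v *)
From HB Require Import structures.
From mathcomp Require Import all_boot.

Set Implicit Arguments.
Unset Strict Implicit.
Unset Printing Implicit Defensive.

Record spanoid (U : finType) := Spanoid {
  rules :> {set {set U} * U};
  rules_refl : forall i : U, ([set i], i) \in rules;
  rules_mono : forall (S S' : {set U}) (i : U),
    (S, i) \in rules -> S \subset S' -> (S', i) \in rules
}.

Section Span.
Variables (U : finType) (S : spanoid U).

Definition derivation_step : rel {set U} :=
  fun T T' => [exists i : U, (T' == T :|: [set i]) &&
                [exists A : {set U}, (A \subset T) && ((A, i) \in rules S)]].

Definition derivable (T : {set U}) (i : U) : bool :=
  [exists T' : {set U}, connect derivation_step T T' && (i \in T')].

Lemma derivableP (T : {set U}) (i : U) :
  reflect (exists2 Ts : seq {set U},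
             path derivation_step T Ts & i \in last T Ts)
          (derivable T i).
Proof.
apply: (iffP existsP) => [[T' /andP[/connectP[Ts pTs ->] iT]] | [Ts pTs iT]].
  by exists Ts.
by exists (last T Ts); rewrite iT andbT; apply/connectP; exists Ts.
Qed.

Definition span (T : {set U}) : {set U} := [set i | derivable T i].

Definition spanning (T : {set U}) : bool := span T == [set: U].

Lemma spanningT : spanning [set: U].
Proof.
apply/eqP/setP => i; rewrite !inE; apply/derivableP.
by exists [::]; rewrite //= inE.
Qed.

Definition rank : nat := #|[arg min_(T < [set: U] | spanning T) #|T| ]|.

Lemma rankP :
  (exists2 T : {set U}, span T = [set: U] & #|T| = rank) /\
  (forall T : {set U}, span T = [set: U] -> rank <= #|T|).
Proof.
rewrite /rank; case: arg_minnP => [|T /eqP spT minT]; first exact: spanningT.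
by split=> [|T' /eqP /minT]; first by exists T.
Qed.

End Span.

Section Product.
Variables (U1 U2 : finType) (S1 : spanoid U1) (S2 : spanoid U2).

Definition prod_gens : {set {set U1 * U2} * (U1 * U2)} :=
  [set (setX r.1 [set j], (r.2, j)) | r in rules S1, j in [set: U2]] :|:
  [set (setX [set i] r.1, (i, r.2)) | i in [set: U1], r in rules S2].

(* A spanoid's rules are by convention closed under enlarging the premise, so
   the product is generated from [prod_gens] by this closure. *)
Definition prod_rules : {set {set U1 * U2} * (U1 * U2)} :=
  [set r : {set U1 * U2} * (U1 * U2) |
    [exists A : {set U1 * U2}, (A \subset r.1) && ((A, r.2) \in prod_gens)]].

Lemma prod_rules_refl (p : U1 * U2) : ([set p], p) \in prod_rules.
Proof.
case: p => i j; rewrite inE; apply/existsP.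
exists (setX [set i] [set j]); apply/andP; split.
  by apply/subsetP => -[a b]; rewrite !inE.
rewrite inE; apply/orP; left; apply/imset2P.
by exists ([set i], i) j; rewrite ?inE ?rules_refl.
Qed.

Lemma prod_rules_mono (A A' : {set U1 * U2}) (p : U1 * U2) :
  (A, p) \in prod_rules -> A \subset A' -> (A', p) \in prod_rules.
Proof.
rewrite !inE /= => /existsP[B /andP[sBA genB]] sAA'; apply/existsP; exists B.
by rewrite (subset_trans sBA sAA').
Qed.

Definition spanoid_prod : spanoid (U1 * U2)%type :=
  Spanoid prod_rules_refl prod_rules_mono.

End Product.

(* Main.v *)
Require Import Defs.
From mathcomp Require Import all_boot.

(** The union of the rectangles [M t × N t] spans the product: inside each fibre
    [{i} × U2] it contains [{i} × N t] for all [t] with [i \in M t], and the rules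
    of [S2] acting in that fibre derive the rest of it. *)

(** Closed sets stand in for explicit derivations below: the span of [T] is the least closed set
    containing [T]. *)
Definition rules_closed {U : finType} (S : spanoid U) (C : {set U}) : Prop :=
  forall (A : {set U}) (i : U), (A, i) \in rules S -> A \subset C -> i \in C.

(** Induction along the derivation: each step adds the conclusion of a rule whose premise already
    lies in [C]. *)
Lemma span_sub_closed {U : finType} (S : spanoid U) (T C : {set U}) :
  rules_closed S C -> T \subset C -> span S T \subset C.
Proof.
move=> clC sTC; apply/subsetP => i; rewrite inE => /derivableP[Ts].
elim: Ts T sTC => [|T' Ts IH] T sTC /=; first by move=> _; apply: (subsetP sTC).
case/andP=> /existsP[k /andP[/eqP-> /existsP[A /andP[sAT Ak]]]].
by apply: IH; rewrite subUset sTC sub1set (clC A) // (subset_trans sAT).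
Qed.

Lemma sub_span {U : finType} (S : spanoid U) (T : {set U}) : T \subset span S T.
Proof.
by apply/subsetP => i iT; rewrite inE; apply/derivableP; exists [::].
Qed.

Lemma span_closed {U : finType} (S : spanoid U) (T : {set U}) :
  rules_closed S (span S T).
Proof.
(* A set of maximal size reachable from [T] is closed, hence it is the span. *)
have [T' TT' maxT'] :=
  @arg_maxnP _ T (connect (derivation_step S) T) (fun X => #|X|) (connect0 _ T).
have clT' : rules_closed S T'.
  (* One more step from [T'] reaches [T' :|: [set i]], which would be strictly larger if [i] were
     outside [T']. *)
  move=> A i Ai sAT'; suff /maxT' : connect (derivation_step S) T (T' :|: [set i]).
    rewrite setUC cardsU1; case: (i \in T') => //=.
    by rewrite add1n /= ltnn.
  apply: connect_trans TT' (connect1 _); apply/existsP; exists i.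
  by rewrite eqxx; apply/existsP; exists A; rewrite sAT'.
(* Derivation steps only enlarge the set. *)
have sTT' : T \subset T'.
  have /connectP[Ts pTs ->] := TT'.
  elim: Ts T {TT' maxT'} pTs => [|X Ts IH] T //= /andP[/existsP[k]].
  by case/andP=> /eqP-> _ /IH; apply: subset_trans; apply: subsetUl.
suff -> : span S T = T' by [].
apply/eqP; rewrite eqEsubset span_sub_closed //.
by apply/subsetP => i iT'; rewrite inE; apply/existsP; exists T'; rewrite TT'.
Qed.

(** A rule [(A, j)] of [S2] lifts to the product rule with premise [setX [set i] A] and conclusion
    [(i, j)]. *)
Lemma fibre_closed {U1 U2 : finType} (S1 : spanoid U1) (S2 : spanoid U2)
    (C : {set U1 * U2}) (i : U1) :
  rules_closed (spanoid_prod S1 S2) C -> rules_closed S2 [set j | (i, j) \in C].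
Proof.
move=> clC A j Aj sA; rewrite inE; apply: (clC (setX [set i] A)).
  rewrite inE; apply/existsP; exists (setX [set i] A); rewrite subxx inE.
  by apply/orP; right; apply/imset2P; exists i (A, j); rewrite ?inE.
apply/subsetP => -[i' k]; rewrite !inE /= => /andP[/eqP-> /(subsetP sA)].
by rewrite inE.
Qed.

Lemma leq_card_bigcup {I T : finType} (F : I -> {set T}) :
  #|\bigcup_i F i| <= \sum_i #|F i|.
Proof.
elim/big_rec2: _ => [|i n A _ leAn]; first by rewrite cards0.
by rewrite (leq_trans (leq_card_setU _ _)) ?leq_add2l.
Qed.

Theorem theorem7 (U1 U2 : finType) (S1 : spanoid U1) (S2 : spanoid U2)
    (s : nat) (M : 'I_s -> {set U1}) (N : 'I_s -> {set U2})
    (spanMN : forall i : U1, span S2 (\bigcup_(t < s | i \in M t) N t) = [set: U2]) :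
  rank (spanoid_prod S1 S2) <= \sum_(t < s) #|M t| * #|N t|.
Proof.
pose T := \bigcup_(t < s) setX (M t) (N t).
have spT : span (spanoid_prod S1 S2) T = [set: U1 * U2].
  apply/setP => -[i j]; rewrite in_setT.
  have clC := fibre_closed _ _ _ i (span_closed (spanoid_prod S1 S2) T).
  have : j \in span S2 (\bigcup_(t < s | i \in M t) N t) by rewrite spanMN inE.
  (* The fibre of [span T] over [i] is closed under [S2], so it suffices that it contains each [N t]
     with [i \in M t]. *)
  move/(subsetP (span_sub_closed _ _ _ clC _)); rewrite inE; apply.
  apply/bigcupsP => t iMt; apply/subsetP => k kNt; rewrite inE.
  apply: (subsetP (sub_span _ _)); apply/bigcupP.
  by exists t; rewrite // inE iMt kNt.
apply: leq_trans ((rankP (spanoid_prod S1 S2)).2 T spT) _.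
(* The rectangles may overlap, so their sizes only bound [#|T|] from above. *)
apply: leq_trans (leq_card_bigcup _) _.
by apply: leq_sum => t _; rewrite cardsX.
Qed.
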